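(* Let $\alpha,\beta,\gamma,\delta\in\mathbb{R}$ with $\alpha+\delta\neq 0$ and $\alpha\gamma=0$, and let $(G_7,g,J)$ be the connected, simply connected three-dimensional Lorentzian Lie group with product structure $J$ whose Lie algebra $\mathfrak{g}$ has a pseudo-orthonormal basis $\{e_1,e_2,e_3\}$ ($e_3$ timelike) with $[e_1,e_2]=-\alpha e_1-\beta e_2-\beta e_3$, $[e_1,e_3]=\alpha e_1+\beta e_2+\beta e_3$, $[e_2,e_3]=\gamma e_1+\delta e_2+\delta e_3$. Let $c\in\mathbb{R}$. Then $(G_7,g,J)$ is a second kind algebraic Ricci soliton associated to the Kobayashi-Nomizu connection $\nabla^1$ with constant $c$ if and only if $\alpha\neq 0$, $\beta=\gamma=0$, $\alpha=2\delta$, $\alpha^2+2c=0$. In particular, in that case $De_1=-\frac{\alpha^2}{2}e_1$, $De_2=-\frac{\alpha^2}{2}e_2-\frac{\alpha^2}{2}e_3$, $De_3=\frac{\alpha^2}{2}e_2+\frac{\alpha^2}{2}e_3$.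
   Context: The left-invariant Lorentzian metric $g$ satisfies $g(e_1,e_1)=g(e_2,e_2)=1$, $g(e_3,e_3)=-1$, $g(e_i,e_j)=0$ for $i\ne j$. All tensors and connections are left-invariant and evaluated on $\mathfrak{g}$. $\nabla$ is the Levi-Civita connection of $g$. The product structure is $Je_1=e_1$, $Je_2=e_2$, $Je_3=-e_3$, and $(\nabla_XJ)Y=\nabla_X(JY)-J(\nabla_XY)$. The canonical connection is $\nabla^0_XY=\nabla_XY-\frac12(\nabla_XJ)(JY)$ and the Kobayashi-Nomizu connection is $\nabla^1_XY=\nabla^0_XY-\frac14[(\nabla_YJ)(JX)-(\nabla_{JY}J)X]$, with curvature $R^1(X,Y)Z=\nabla^1_X\nabla^1_YZ-\nabla^1_Y\nabla^1_XZ-\nabla^1_{[X,Y]}Z$. Its Ricci tensor is $\rho^1(X,Y)=-g(R^1(X,e_1)Y,e_1)-g(R^1(X,e_2)Y,e_2)+g(R^1(X,e_3)Y,e_3)$; its symmetrization is $\widetilde\rho^1(X,Y)=\frac12(\rho^1(X,Y)+\rho^1(Y,X))$, and the operator $\widetilde{\mathrm{Ric}}^1$ is defined by $\widetilde\rho^1(X,Y)=g(\widetilde{\mathrm{Ric}}^1(X),Y)$. Second kind algebraic Ricci soliton associated to $\nabla^1$ with constant $c$ means: $\widetilde{\mathrm{Ric}}^1=c\,\mathrm{Id}+D$ where $D$ is a derivation of $\mathfrak{g}$, i.e. a linear map with $D[X,Y]=[DX,Y]+[X,DY]$ for all $X,Y\in\mathfrak{g}$. *)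

(* Defs.v *)
From HB Require Import structures.
From mathcomp Require Import all_boot all_order all_algebra.
From mathcomp Require Export sesquilinear.
From mathcomp Require Import reals.

Set Implicit Arguments.
Unset Strict Implicit.
Unset Printing Implicit Defensive.

Import Order.TTheory GRing.Theory Num.Theory.
Local Open Scope ring_scope.

(* Left-invariant tensors and connections on a Lie group are represented by   *)
(* their values on its Lie algebra V, whose bracket is [br]; a left-invariant *)
(* connection is an operation V -> V -> V, with [nabla X Y] for nabla_X Y.    *)

Section LieAlgebra.
Variables (R : realType) (V : vectType R) (br : V -> V -> V).

Definition is_lie_bracket : Prop :=
  (forall X, br X X = 0) /\
  (forall X Y Z, br X (br Y Z) + br Y (br Z X) + br Z (br X Y) = 0).

Definition is_derivation (D : V -> V) : Prop :=
  forall X Y, D (br X Y) = br (D X) Y + br X (D Y).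

Definition curvature (nabla : V -> V -> V) (X Y Z : V) : V :=
  nabla X (nabla Y Z) - nabla Y (nabla X Z) - nabla (br X Y) Z.

(* For left-invariant fields g(Y, Z) is a constant function, so the term      *)
(* X(g(Y, Z)) of metric compatibility vanishes.                               *)
Definition is_levi_civita (g : V -> V -> R) (nabla : V -> V -> V) : Prop :=
  (forall X Y, nabla X Y - nabla Y X = br X Y) /\
  (forall X Y Z, g (nabla X Y) Z + g Y (nabla X Z) = 0).

End LieAlgebra.

Section ProductConnections.
Variables (R : realType) (V : vectType R) (J : V -> V) (nabla : V -> V -> V).

(* (nabla_X J) Y *)
Definition cov_deriv (X Y : V) : V := nabla X (J Y) - J (nabla X Y).

Definition canonical_connection (X Y : V) : V :=
  nabla X Y - 2^-1 *: cov_deriv X (J Y).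

Definition kobayashi_nomizu_connection (X Y : V) : V :=
  canonical_connection X Y
  - 4^-1 *: (cov_deriv Y (J X) - cov_deriv (J Y) X).

End ProductConnections.

Section Soliton.
Variables (R : realType) (V : vectType R).
Variables (br : V -> V -> V) (g : V -> V -> R) (J : V -> V).
Variables (e1 e2 e3 : V).

(* The last vector is timelike. *)
Definition pseudo_orthonormal_basis : Prop :=
  [/\ basis_of fullv [:: e1; e2; e3],
      [/\ g e1 e1 = 1, g e2 e2 = 1 & g e3 e3 = -1] &
      [/\ g e1 e2 = 0, g e1 e3 = 0 & g e2 e3 = 0]].

Definition is_product_structure : Prop :=
  [/\ J e1 = e1, J e2 = e2 & J e3 = - e3].

Definition ricci_tensor (nabla : V -> V -> V) (X Y : V) : R :=
  - g (curvature br nabla X e1 Y) e1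
  - g (curvature br nabla X e2 Y) e2
  + g (curvature br nabla X e3 Y) e3.

Definition sym_ricci_tensor (nabla : V -> V -> V) (X Y : V) : R :=
  2^-1 * (ricci_tensor nabla X Y + ricci_tensor nabla Y X).

Definition is_sym_ricci_operator (nabla : V -> V -> V) (Ric : V -> V) : Prop :=
  forall X Y, sym_ricci_tensor nabla X Y = g (Ric X) Y.

(* Here [nabla] is the Levi-Civita connection; the Ricci operator is that of  *)
(* the Kobayashi-Nomizu connection built from it.                             *)
Definition second_kind_soliton_with (nabla : V -> V -> V) (c : R)
    (D : 'End(V)) : Prop :=
  is_derivation br D /\
  exists Ric : 'End(V),
    is_sym_ricci_operator (kobayashi_nomizu_connection J nabla) Ric /\
    forall X, Ric X = c *: X + D X.

Definition second_kind_soliton (nabla : V -> V -> V) (c : R) : Prop :=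
  exists D : 'End(V), second_kind_soliton_with nabla c D.

Definition g7_brackets (alpha beta gamma delta : R) : Prop :=
  [/\ br e1 e2 = - alpha *: e1 - beta *: e2 - beta *: e3,
      br e1 e3 = alpha *: e1 + beta *: e2 + beta *: e3 &
      br e2 e3 = gamma *: e1 + delta *: e2 + delta *: e3].

End Soliton.

(* Main.v *)
(* In the frame (e1, e2, e3) the Koszul formula determines the Levi-Civita    *)
(* connection, hence the Kobayashi-Nomizu connection and its symmetrized      *)
(* Ricci operator, whose entries are quadratic in alpha, beta, gamma, delta.  *)
(* As g is nondegenerate, the only candidate for D is Ric - c Id.  The        *)
(* derivation identity on the brackets of the frame is then a polynomial      *)
(* system: eliminating c gives beta (3 delta + alpha) (alpha + delta) = 0,    *)
(* which leads to beta = 0, after which both alpha and delta annihilate       *)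
(* 2 delta - alpha; since alpha + delta <> 0 the stated family remains.       *)

Require Import Defs.
From HB Require Import structures.
From mathcomp Require Import all_boot all_order all_algebra.
From mathcomp Require Import reals.
From mathcomp Require Import ring lra.

Import Order.TTheory GRing.Theory Num.Theory.
Local Open Scope ring_scope.

Set Implicit Arguments.
Unset Strict Implicit.

(** Every vector is written as a coordinate triple [frame_vec x y z], so each tensor identity
    becomes three scalar identities. Pairing with the frame through [g] recovers coordinates, which
    determines the Levi-Civita connection from the Koszul formula and the Ricci operator from its
    bilinear form. [soliton_derivation_frame_vec] therefore leaves one candidate for [D], and the
    soliton condition says only that this candidate is a derivation. [soliton_parameters] solves the
    resulting polynomial system; [soliton_exists] checks that its solutions do give a derivation. *)

Section FrameCoordinates.
Variables (R : realType) (V : vectType R) (e1 e2 e3 : V).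

(** * Coordinates in a frame *)

Definition frame_vec (x y z : R) : V := x *: e1 + y *: e2 + z *: e3.

Lemma frame_vecD x1 x2 x3 y1 y2 y3 :
  frame_vec x1 x2 x3 + frame_vec y1 y2 y3 =
  frame_vec (x1 + y1) (x2 + y2) (x3 + y3).
Proof. by rewrite /frame_vec !scalerDl addrACA [X in X + _]addrACA. Qed.

Lemma frame_vecZ a x1 x2 x3 :
  a *: frame_vec x1 x2 x3 = frame_vec (a * x1) (a * x2) (a * x3).
Proof. by rewrite /frame_vec !scalerDr !scalerA. Qed.

Lemma frame_vecN x1 x2 x3 :
  - frame_vec x1 x2 x3 = frame_vec (- x1) (- x2) (- x3).
Proof. by rewrite /frame_vec !scaleNr !opprD. Qed.

Definition frame_vecE := (frame_vecD, frame_vecZ, frame_vecN).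

Lemma frame_vec_e1 : e1 = frame_vec 1 0 0.
Proof. by rewrite /frame_vec scale1r !scale0r !addr0. Qed.

Lemma frame_vec_e2 : e2 = frame_vec 0 1 0.
Proof. by rewrite /frame_vec scale1r !scale0r add0r addr0. Qed.

Lemma frame_vec_e3 : e3 = frame_vec 0 0 1.
Proof. by rewrite /frame_vec scale1r !scale0r !add0r. Qed.

Lemma frame_vecP (X : V) :
  basis_of fullv [:: e1; e2; e3] -> exists x y z, X = frame_vec x y z.
Proof.
move=> /span_basis spanE; have := memvf X; rewrite -spanE.
rewrite !span_cons span_nil addv0 => /memv_addP[_ /vlineP[x ->]].
move=> [_ /memv_addP[_ /vlineP[y ->] [_ /vlineP[z ->] ->]] ->].
by exists x, y, z; rewrite /frame_vec addrA.
Qed.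

Lemma linear_frame_vec (f : 'End(V)) x y z :
  f (frame_vec x y z) = x *: f e1 + y *: f e2 + z *: f e3.
Proof. by rewrite /frame_vec !linearD !linearZ. Qed.

Lemma bilinear_frame_vec (f : {bilinear V -> V -> V}) x1 x2 x3 y1 y2 y3 :
  f (frame_vec x1 x2 x3) (frame_vec y1 y2 y3) =
  x1 *: (y1 *: f e1 e1 + y2 *: f e1 e2 + y3 *: f e1 e3)
  + x2 *: (y1 *: f e2 e1 + y2 *: f e2 e2 + y3 *: f e2 e3)
  + x3 *: (y1 *: f e3 e1 + y2 *: f e3 e2 + y3 *: f e3 e3).
Proof.
by rewrite /frame_vec !linearDl !linearZl_LR !linearDr !linearZr_LR.
Qed.

(** * The Lorentzian metric and the Koszul formula *)

Section Metric.
Variable g : {biscalar V}.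
Hypotheses (g_sym : forall X Y : V, g X Y = g Y X)
           (e_basis : pseudo_orthonormal_basis g e1 e2 e3).

Lemma metric_frame_vec x1 x2 x3 y1 y2 y3 :
  g (frame_vec x1 x2 x3) (frame_vec y1 y2 y3) = x1 * y1 + x2 * y2 - x3 * y3.
Proof.
have [_ [g11 g22 g33] [g12 g13 g23]] := e_basis.
rewrite /frame_vec !linearDl !linearZl_LR !linearDr !linearZr_LR /=.
rewrite [g e2 e1]g_sym [g e3 e1]g_sym [g e3 e2]g_sym.
rewrite g11 g22 g33 g12 g13 g23; ring.
Qed.

Lemma metric_frame_vec_e1 x y z : g (frame_vec x y z) e1 = x.
Proof.
by have := metric_frame_vec x y z 1 0 0; rewrite -frame_vec_e1 => ->; ring.
Qed.

Lemma metric_frame_vec_e2 x y z : g (frame_vec x y z) e2 = y.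
Proof.
by have := metric_frame_vec x y z 0 1 0; rewrite -frame_vec_e2 => ->; ring.
Qed.

Lemma metric_frame_vec_e3 x y z : g (frame_vec x y z) e3 = - z.
Proof.
by have := metric_frame_vec x y z 0 0 1; rewrite -frame_vec_e3 => ->; ring.
Qed.

Definition metric_frame_vec_basis :=
  (metric_frame_vec_e1, metric_frame_vec_e2, metric_frame_vec_e3).

(** The sign on the last coordinate compensates for [e3] being timelike. *)
Lemma frame_vec_metric (X : V) : X = frame_vec (g X e1) (g X e2) (- g X e3).
Proof.
have [eB _ _] := e_basis; have [x [y [z ->]]] := frame_vecP X eB.
by rewrite !metric_frame_vec_basis opprK.
Qed.

Lemma frame_vec_inj x1 x2 x3 y1 y2 y3 :
  frame_vec x1 x2 x3 = frame_vec y1 y2 y3 -> [/\ x1 = y1, x2 = y2 & x3 = y3].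
Proof.
move=> eqxy; split.
- by rewrite -(metric_frame_vec_e1 x1 x2 x3) eqxy metric_frame_vec_e1.
- by rewrite -(metric_frame_vec_e2 x1 x2 x3) eqxy metric_frame_vec_e2.
- apply: oppr_inj.
  by rewrite -(metric_frame_vec_e3 x1 x2 x3) eqxy metric_frame_vec_e3.
Qed.

(** The three cyclic instances of metric compatibility are combined, torsion-freeness turning
    differences of [nabla] into brackets. By left-invariance only the bracket terms of the usual
    formula survive. *)
Lemma koszul_formula (br nabla : {bilinear V -> V -> V}) :
  is_levi_civita br g nabla -> forall X Y Z,
  2 * g (nabla X Y) Z = g (br X Y) Z - g (br Y Z) X + g (br Z X) Y.
Proof.
move=> [torsion_free compat] X Y Z; rewrite -!torsion_free !linearBl /=.
have := compat X Y Z; have := compat Y Z X; have := compat Z X Y.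
by rewrite [g Z _]g_sym [g X _]g_sym [g Y _]g_sym; lra.
Qed.

(** * Connections and Ricci operator of the Lie algebra *)

Section G7.
Variables (alpha beta gamma delta : R).
Variables (br nabla : {bilinear V -> V -> V}) (J : 'End(V)).
Hypotheses (br_lie : is_lie_bracket br)
           (br_g7 : g7_brackets br e1 e2 e3 alpha beta gamma delta)
           (J_product : is_product_structure J e1 e2 e3)
           (nabla_LC : is_levi_civita br g nabla).

Lemma product_structure_frame_vec x y z :
  J (frame_vec x y z) = frame_vec x y (- z).
Proof.
have [J1 J2 J3] := J_product.
by rewrite linear_frame_vec J1 J2 J3 /frame_vec scalerN scaleNr.
Qed.

Lemma lie_bracketC X Y : br X Y = - br Y X.
Proof.
have [brxx _] := br_lie; apply/eqP; rewrite -addr_eq0; apply/eqP.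
by have := brxx (X + Y); rewrite linearDl !linearDr /= !brxx addr0 add0r.
Qed.

(** By antisymmetry only the 2x2 minors of the coordinates enter. The last two components agree: all
    brackets lie in the span of [e1] and [e2 + e3]. *)
Lemma g7_frame_vec x1 x2 x3 y1 y2 y3 :
  br (frame_vec x1 x2 x3) (frame_vec y1 y2 y3) =
  let p12 := x1 * y2 - x2 * y1 in
  let p13 := x1 * y3 - x3 * y1 in
  let p23 := x2 * y3 - x3 * y2 in
  frame_vec (alpha * (p13 - p12) + gamma * p23)
            (beta * (p13 - p12) + delta * p23)
            (beta * (p13 - p12) + delta * p23).
Proof.
have [brxx _] := br_lie; have [br12 br13 br23] := br_g7.
rewrite bilinear_frame_vec !brxx.
rewrite (lie_bracketC e2 e1) (lie_bracketC e3 e1) (lie_bracketC e3 e2).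
have -> : br e1 e2 = frame_vec (- alpha) (- beta) (- beta).
  by rewrite br12 /frame_vec !scaleNr.
have -> : br e1 e3 = frame_vec alpha beta beta by [].
have -> : br e2 e3 = frame_vec gamma delta delta by [].
have -> : 0 = frame_vec 0 0 0 by rewrite /frame_vec !scale0r !addr0.
by rewrite !frame_vecE; congr frame_vec; ring.
Qed.

Lemma levi_civita_frame_vec x1 x2 x3 y1 y2 y3 :
  nabla (frame_vec x1 x2 x3) (frame_vec y1 y2 y3) =
  frame_vec
    (x1 * alpha * (y3 - y2)
     + x2 * ((gamma / 2 + beta) * y3 - beta * y2)
     + x3 * ((beta - gamma / 2) * y2 - beta * y3))
    (x1 * (alpha * y1 + gamma / 2 * y3)
     + x2 * (beta * y1 + delta * y3)
     + x3 * ((gamma / 2 - beta) * y1 - delta * y3))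
    (x1 * (alpha * y1 + gamma / 2 * y2)
     + x2 * ((gamma / 2 + beta) * y1 + delta * y2)
     - x3 * (beta * y1 + delta * y2)).
Proof.
have [eB _ _] := e_basis.
have [n1 [n2 [n3 nE]]] :=
  frame_vecP (nabla (frame_vec x1 x2 x3) (frame_vec y1 y2 y3)) eB.
have koszul z1 z2 z3 := koszul_formula nabla_LC
  (frame_vec x1 x2 x3) (frame_vec y1 y2 y3) (frame_vec z1 z2 z3).
move: koszul; rewrite nE => koszul.
(* Testing against the three frame vectors isolates the unknown coordinates [n1], [n2], [n3]. *)
have := (koszul 1 0 0, koszul 0 1 0, koszul 0 0 1).
rewrite !g7_frame_vec !metric_frame_vec => -[[k1 k2] k3].
by congr frame_vec; lra.
Qed.

(** The first two components involve only [y1], [y2] and the last only [y3]: this connection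
    preserves both eigenspaces of [J]. *)
Lemma kobayashi_nomizu_frame_vec x1 x2 x3 y1 y2 y3 :
  kobayashi_nomizu_connection J nabla
    (frame_vec x1 x2 x3) (frame_vec y1 y2 y3) =
  frame_vec
    (- (x1 * alpha * y2 + x2 * beta * y2 + x3 * (alpha * y1 + gamma * y2)))
    (x1 * alpha * y1 + x2 * beta * y1 - x3 * (beta * y1 + delta * y2))
    ((x1 * beta + x2 * delta) * y3).
Proof.
rewrite /kobayashi_nomizu_connection /canonical_connection /cov_deriv.
do ![rewrite ?product_structure_frame_vec ?levi_civita_frame_vec ?frame_vecE].
by congr frame_vec; field.
Qed.

(** The coefficients of [x1 * y2] and [x2 * y1] differ in general, so this form is not symmetric;
    hence the later symmetrization. *)
Lemma kobayashi_nomizu_ricci_frame_vec x1 x2 x3 y1 y2 y3 :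
  ricci_tensor br g e1 e2 e3 (kobayashi_nomizu_connection J nabla)
    (frame_vec x1 x2 x3) (frame_vec y1 y2 y3) =
  - alpha ^+ 2 * x1 * y1 + beta * delta * x1 * y2
  + (beta * delta + alpha * beta) * x1 * y3
  - alpha * beta * x2 * y1 - (beta * gamma + beta ^+ 2 + alpha ^+ 2) * x2 * y2
  + (delta ^+ 2 + beta * gamma) * x2 * y3
  + (beta * delta + alpha * beta) * x3 * y1
  + (delta ^+ 2 + alpha * delta) * x3 * y2.
Proof.
set X := frame_vec x1 x2 x3; set Y := frame_vec y1 y2 y3.
(* Each term of the trace is put in coordinates, so that the formulas for [frame_vec] apply to the
   basis vectors too. *)
pose K z1 z2 z3 := let Z := frame_vec z1 z2 z3 in
  g (curvature br (kobayashi_nomizu_connection J nabla) X Z Y) Z.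
transitivity (- K 1 0 0 - K 0 1 0 + K 0 0 1).
  by rewrite /K -frame_vec_e1 -frame_vec_e2 -frame_vec_e3.
rewrite /K /curvature /X /Y /=.
do ![rewrite ?kobayashi_nomizu_frame_vec ?g7_frame_vec /= ?frame_vecE].
by rewrite !metric_frame_vec; ring.
Qed.

(** Off-diagonal entries are averages of opposite Ricci coefficients; the last row changes sign
    because [g e3 e3 = -1]. *)
Definition g7_ricci_operator x y z :=
  frame_vec
    (- alpha ^+ 2 * x + beta * (delta - alpha) / 2 * y
     + beta * (alpha + delta) * z)
    (beta * (delta - alpha) / 2 * x
     - (beta * gamma + beta ^+ 2 + alpha ^+ 2) * y
     + (delta ^+ 2 + (beta * gamma + alpha * delta) / 2) * z)
    (- (beta * (alpha + delta) * x
     + (delta ^+ 2 + (beta * gamma + alpha * delta) / 2) * y)).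

Lemma sym_ricci_frame_vec x1 x2 x3 y1 y2 y3 :
  sym_ricci_tensor br g e1 e2 e3 (kobayashi_nomizu_connection J nabla)
    (frame_vec x1 x2 x3) (frame_vec y1 y2 y3) =
  g (g7_ricci_operator x1 x2 x3) (frame_vec y1 y2 y3).
Proof.
rewrite /sym_ricci_tensor !kobayashi_nomizu_ricci_frame_vec metric_frame_vec.
by field.
Qed.

(** * The derivation condition *)

Section Soliton.
Variable c : R.
Hypothesis alphaDdelta_neq0 : alpha + delta != 0.
Hypothesis alphaMgamma_eq0 : alpha * gamma = 0.

Lemma soliton_derivation_frame_vec (D : 'End(V)) x y z :
  second_kind_soliton_with br g J e1 e2 e3 nabla c D ->
  D (frame_vec x y z) = g7_ricci_operator x y z - c *: frame_vec x y z.
Proof.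
move=> [_ [Ric [RicP RicE]]].
suff <- : Ric (frame_vec x y z) = g7_ricci_operator x y z.
  by rewrite RicE addrAC subrr add0r.
have ricg x' y' z' : g (Ric (frame_vec x y z)) (frame_vec x' y' z') =
    g (g7_ricci_operator x y z) (frame_vec x' y' z').
  by rewrite -RicP sym_ricci_frame_vec.
have [eB _ _] := e_basis.
have [n1 [n2 [n3 RicE']]] := frame_vecP (Ric (frame_vec x y z)) eB.
have := (ricg 1 0 0, ricg 0 1 0, ricg 0 0 1).
rewrite RicE' !metric_frame_vec => -[[r1 r2] r3].
by congr frame_vec; lra.
Qed.

(** The term [- c Id] of [D] contributes [c] times the bracket to the derivation defect. Since
    [[e1, e2] = - [e1, e3]] and the last two components of a bracket agree, the combinations of
    equations used below are free of [c]. *)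
Lemma soliton_parameters (D : 'End(V)) :
  second_kind_soliton_with br g J e1 e2 e3 nabla c D ->
  [/\ alpha != 0, beta = 0 /\ gamma = 0, alpha = 2 * delta
    & alpha ^+ 2 + 2 * c = 0].
Proof.
move=> solD; have [derD _] := solD.
have D_vec x y z := soliton_derivation_frame_vec x y z solD.
have der x1 x2 x3 y1 y2 y3 :=
  derD (frame_vec x1 x2 x3) (frame_vec y1 y2 y3).
have := der 1 0 0 0 1 0; have := der 1 0 0 0 0 1; have := der 0 1 0 0 0 1.
do ![rewrite ?D_vec ?g7_frame_vec /= /g7_ricci_operator ?frame_vecE].
(* [Eijk] is the [ek]-component of the derivation identity on [[ei, ej]]. *)
move=> /frame_vec_inj[E231 E232 E233] /frame_vec_inj[E131 E132 E133].
move=> /frame_vec_inj[E121 E122 E123].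
have beta0 : beta = 0.
  (* E122 + E133 *)
  have : beta * (3 * delta + alpha) * (alpha + delta) = 0 by lra.
  move/eqP; rewrite mulf_eq0 (negPf alphaDdelta_neq0) orbF mulf_eq0.
  move=> /orP[/eqP//|/eqP alphaE].
  have {}alphaE : alpha = - (3 * delta) by lra.
  (* E123 + E132 *)
  have : beta * (10 * delta ^+ 2 + beta ^+ 2) = 0.
    by move: E123 E132; rewrite alphaE; lra.
  move/eqP; rewrite mulf_eq0 => /orP[/eqP//|]; rewrite paddr_eq0 ?sqr_ge0//.
    by rewrite sqrf_eq0 => /andP[_ /eqP].
  by rewrite mulr_ge0 ?sqr_ge0.
rewrite beta0 in E231 E232 E233 E131 E121.
(* E121 + E131 *)
have Ealpha : alpha * (2 * delta - alpha) = 0.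
  apply/eqP; rewrite -(mulIr_eq0 _ (mulIf alphaDdelta_neq0)); apply/eqP; lra.
(* E232 - E233 *)
have Edelta : delta * (2 * delta - alpha) = 0.
  apply/eqP; rewrite -(mulIr_eq0 _ (mulIf alphaDdelta_neq0)); apply/eqP; lra.
have alphaE : alpha = 2 * delta.
  have : (alpha + delta) * (2 * delta - alpha) = 0 by lra.
  move/eqP; rewrite mulf_eq0 (negPf alphaDdelta_neq0) /= => /eqP; lra.
have alpha_neq0 : alpha != 0.
  by apply: contraNneq alphaDdelta_neq0 => alpha0; apply/eqP; lra.
have gamma0 : gamma = 0.
  by move/eqP: alphaMgamma_eq0; rewrite mulf_eq0 (negPf alpha_neq0) => /eqP.
(* On the family found so far, [E131] amounts to [alpha] times the wanted relation for [c]. *)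
split=> //; apply: (mulfI alpha_neq0).
by move: E131; rewrite gamma0 alphaE; lra.
Qed.

(** Reading coordinates through [g] makes the coordinate formula a function on [V], hence a genuine
    linear map. *)
Lemma g7_ricci_endomorphism :
  exists Ric : 'End(V), forall x y z,
    Ric (frame_vec x y z) = g7_ricci_operator x y z.
Proof.
pose f X := g7_ricci_operator (g X e1) (g X e2) (- g X e3).
have lin_f : linear f.
  move=> a X Y; rewrite /f !linearPl /g7_ricci_operator !frame_vecE /=.
  by congr frame_vec; ring.
pose fL : {linear V -> V} := HB.pack f (GRing.isLinear.Build _ _ _ _ f lin_f).
exists (linfun fL) => x y z.
by rewrite lfunE /= /f !metric_frame_vec_basis opprK.
Qed.

Lemma soliton_exists :
  [/\ beta = 0 /\ gamma = 0, alpha = 2 * delta & alpha ^+ 2 + 2 * c = 0] ->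
  second_kind_soliton br g J e1 e2 e3 nabla c.
Proof.
move=> [[beta0 gamma0] alphaE alphac].
have cE : c = - 2 * delta ^+ 2 by move: alphac; rewrite alphaE; lra.
have [eB _ _] := e_basis.
have [Ric RicE] := g7_ricci_endomorphism.
have DE X : (Ric - c *: \1%VF) X = Ric X - c *: X.
  by rewrite add_lfunE opp_lfunE scale_lfunE id_lfunE.
exists (Ric - c *: \1%VF); split; last first.
  exists Ric; split=> [X Y|X]; last by rewrite DE addrC subrK.
  have [x1 [x2 [x3 ->]]] := frame_vecP X eB.
  have [y1 [y2 [y3 ->]]] := frame_vecP Y eB.
  by rewrite RicE sym_ricci_frame_vec.
move=> X Y; rewrite !DE.
have [x1 [x2 [x3 ->]]] := frame_vecP X eB.
have [y1 [y2 [y3 ->]]] := frame_vecP Y eB.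
do ![rewrite ?g7_frame_vec /= ?RicE /g7_ricci_operator ?frame_vecE].
by rewrite cE beta0 gamma0 alphaE; congr frame_vec; field.
Qed.

End Soliton.
End G7.
End Metric.
End FrameCoordinates.

Unset Implicit Arguments.
Set Strict Implicit.

Theorem theorem3p27 (R : realType) (alpha beta gamma delta : R)
    (V : vectType R) (br : {bilinear V -> V -> V}) (g : {biscalar V})
    (J : 'End(V)) (e1 e2 e3 : V) (nabla : {bilinear V -> V -> V}) (c : R)
    (alphaDdelta_neq0 : alpha + delta != 0)
    (alphaMgamma_eq0 : alpha * gamma = 0)
    (br_lie : is_lie_bracket br)
    (br_g7 : g7_brackets br e1 e2 e3 alpha beta gamma delta)
    (g_sym : forall X Y : V, g X Y = g Y X)
    (e_basis : pseudo_orthonormal_basis g e1 e2 e3)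
    (J_product : is_product_structure J e1 e2 e3)
    (nabla_LC : is_levi_civita br g nabla) :
  (second_kind_soliton br g J e1 e2 e3 nabla c <->
     [/\ alpha != 0, beta = 0 /\ gamma = 0, alpha = 2 * delta
       & alpha ^+ 2 + 2 * c = 0]) /\
  (forall D : 'End(V),
     second_kind_soliton_with br g J e1 e2 e3 nabla c D ->
     [/\ D e1 = - (alpha ^+ 2 / 2) *: e1,
         D e2 = - (alpha ^+ 2 / 2) *: e2 - (alpha ^+ 2 / 2) *: e3
       & D e3 = (alpha ^+ 2 / 2) *: e2 + (alpha ^+ 2 / 2) *: e3]).
Proof.
have solP D := soliton_parameters g_sym e_basis br_lie br_g7 J_product
  nabla_LC alphaDdelta_neq0 alphaMgamma_eq0 (c := c) (D := D).
split; first split=> [[D /solP//]|[_ bg alphaE cE]].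
  by apply: (soliton_exists g_sym e_basis br_lie br_g7 J_product nabla_LC).
move=> D solD; have [_ [beta0 gamma0] alphaE cE] := solP D solD.
(* On the solution family [D] scales [e1], kills [e2 + e3] and maps the span of [e2], [e3] into the
   line of [e2 + e3]. *)
have D_vec x y z :
    D (frame_vec e1 e2 e3 x y z) = frame_vec e1 e2 e3 (- (alpha ^+ 2 / 2) * x)
      (alpha ^+ 2 / 2 * (z - y)) (alpha ^+ 2 / 2 * (z - y)).
  rewrite (soliton_derivation_frame_vec g_sym e_basis br_lie br_g7 J_product
    nabla_LC x y z solD) /g7_ricci_operator !frame_vecE.
  have -> : c = - (alpha ^+ 2 / 2) by lra.
  by rewrite beta0 gamma0 alphaE; congr frame_vec; field.
have := (D_vec 1 0 0, D_vec 0 1 0, D_vec 0 0 1).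
rewrite -frame_vec_e1 -frame_vec_e2 -frame_vec_e3 => -[[-> ->] ->].
rewrite /frame_vec !subrr subr0 sub0r !mulr0 !mulr1 !mulrN1.
by rewrite !scale0r !add0r !addr0 !scaleNr.
Qed.
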